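(* There exists a unique kernel $K_\infty:X_{\mathrm{fin}}\times X_{\mathrm{fin}}\to\mathbb{C}$ with the following properties. (1) For every $s,t\in X_{\mathrm{fin}}$, $K_\infty(s,t)=\lim_{n\to\infty}K_n(s,t)$. (2) $K_\infty$ is positive definite on $X_{\mathrm{fin}}$. (3) $K_\infty$ is $L$-invariant on $X_{\mathrm{fin}}$: for every $s,t\in X_{\mathrm{fin}}$, $(LK_\infty)(s,t)=K_\infty(s,t)$; and $K_\infty\ge K$ on $X_{\mathrm{fin}}$ in the kernel order. (4) If $J$ is any kernel on $X_{\mathrm{fin}}$ such that $J\ge K$ (on $X_{\mathrm{fin}}$) and $LJ=J$, then $J\ge K_\infty$ on $X_{\mathrm{fin}}$ in the kernel order.
   Context: Let $X$ be a set, $m\ge1$ an integer, and $\varphi_1,\dots,\varphi_m:X\to X$ maps. A kernel $J:Y\times Y\to\mathbb{C}$ on a set $Y$ is positive definite if $\sum_{\alpha,\beta}\overline{c_\alpha}c_\beta J(s_\alpha,s_\beta)\ge0$ for all finite families $(c_\alpha,s_\alpha)\in\mathbb{C}\times Y$; in the kernel (Loewner) order, $J_1\le J_2$ on $Y$ means that $J_2-J_1$ is positive definite on $Y$. The pullback operator is $(LJ)(s,t):=\sum_{i=1}^m J(\varphi_i(s),\varphi_i(t))$. Fix a positive definite kernel $K$ on $X$ with $LK\ge K$. Set $K_0:=K$, $K_{n+1}:=LK_n$ for $n\ge0$, and $u_n(s):=K_n(s,s)$. The sequence $u_n(s)$ is nondecreasing; let $u_\infty(s):=\lim_n u_n(s)\in[0,\infty]$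 and $X_{\mathrm{fin}}:=\{s\in X:u_\infty(s)<\infty\}$. Each $\varphi_i$ maps $X_{\mathrm{fin}}$ into itself, so $L$ acts by the same formula on kernels on $X_{\mathrm{fin}}$. *)

(* Defs.v *)
From HB Require Import structures.
From mathcomp Require Import all_boot all_order all_algebra complex.
From mathcomp Require Import all_classical all_reals all_analysis.
Set Implicit Arguments.
Unset Strict Implicit.
Unset Printing Implicit Defensive.
Import Order.TTheory GRing.Theory Num.Theory numFieldNormedType.Exports.

Local Open Scope classical_set_scope.
Local Open Scope ring_scope.
Local Open Scope complex_scope.
Local Open Scope ring_scope.

Definition ckernel (R : realType) (Y : Type) := Y -> Y -> R[i].

(* In the order of the complex numbers, [0 <= z] means that z is real and
   nonnegative. *)
Definition posdef (R : realType) (Y : Type) (J : ckernel R Y) : Prop :=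
  forall (n : nat) (c : 'I_n -> R[i]) (s : 'I_n -> Y),
    0 <= \sum_(a < n) \sum_(b < n) Num.conj (c a) * c b * J (s a) (s b).

Definition kernel_le (R : realType) (Y : Type) (J1 J2 : ckernel R Y) : Prop :=
  posdef (fun s t => J2 s t - J1 s t).

Definition pullback (R : realType) (Y : Type) (m : nat)
    (phi : 'I_m -> Y -> Y) (J : ckernel R Y) : ckernel R Y :=
  fun s t => \sum_(i < m) J (phi i s) (phi i t).

Definition kernel_restr (R : realType) (Y : Type) (A : set Y)
    (J : ckernel R Y) : ckernel R A :=
  fun s t => J (val s) (val t).

Section Iterates.
Context (R : realType) (X : Type) (m : nat).
Variables (phi : 'I_m -> X -> X) (K : ckernel R X).

Definition Kn (n : nat) : ckernel R X := iter n (pullback phi) K.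

(* The diagonal values K_n(s, s) are real when K is positive definite
   (lemma [Kn_diag]), so taking the real part loses nothing. *)
Definition un (n : nat) (s : X) : R := complex.Re (Kn n s s).

Definition u_infty (s : X) : \bar R := limn (fun n => (un n s)%:E).

Definition Xfin : set X := [set s | (u_infty s < +oo)%E].

Lemma posdef_diag (Y : Type) (J : ckernel R Y) (s : Y) : posdef J -> 0 <= J s s.
Proof.
move=> /(_ 1%N (fun=> 1) (fun=> s)).
by rewrite !big_ord1 conjC1 !mul1r.
Qed.

Lemma posdef_pullback (J : ckernel R X) : posdef J -> posdef (pullback phi J).
Proof.
move=> Jpd n c s; rewrite /pullback.
have -> : \sum_(a < n) \sum_(b < n) Num.conj (c a) * c b *
      (\sum_(i < m) J (phi i (s a)) (phi i (s b))) =
    \sum_(i < m) \sum_(a < n) \sum_(b < n) Num.conj (c a) * c b *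
      J (phi i (s a)) (phi i (s b)).
  rewrite [RHS]exchange_big /=; apply: eq_bigr => a _.
  rewrite [RHS]exchange_big /=; apply: eq_bigr => b _.
  by rewrite mulr_sumr.
by apply: sumr_ge0 => i _; exact: (Jpd n c (fun a => phi i (s a))).
Qed.

Hypothesis Kpd : posdef K.

Lemma posdef_Kn n : posdef (Kn n).
Proof. by elim: n => [//|n IHn]; exact: posdef_pullback. Qed.

Lemma Kn_diag n s : Kn n s s = (un n s)%:C.
Proof.
have := posdef_diag s (@posdef_Kn n); rewrite /un.
case: (Kn n s s) => a b; rewrite lecE /= => /andP[/eqP ib _].
by rewrite ib.
Qed.

Lemma un_ge0 n s : 0 <= un n s.
Proof.
have := posdef_diag s (@posdef_Kn n); rewrite /un.
by case: (Kn n s s) => a b; rewrite lecE /= => /andP[].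
Qed.

Lemma unS n s : un n.+1 s = \sum_(i < m) un n (phi i s).
Proof. by rewrite /un raddf_sum. Qed.

Lemma un_phi_le n i s : un n (phi i s) <= un n.+1 s.
Proof.
rewrite unS (bigD1 i) //= lerDl.
by apply: sumr_ge0 => j _; exact: un_ge0.
Qed.

Hypothesis LK_ge_K : kernel_le K (pullback phi K).

Lemma Kn_leS n : kernel_le (Kn n) (Kn n.+1).
Proof.
elim: n => [//|n /posdef_pullback]; congr posdef.
by apply/funext => s; apply/funext => t; rewrite /pullback sumrB.
Qed.

Lemma un_nondecreasing s : nondecreasing_seq (un ^~ s).
Proof.
apply/nondecreasing_seqP => n.
have := posdef_diag s (@Kn_leS n).
by rewrite !Kn_diag lecE /= subr_ge0 => /andP[].
Qed.

Lemma Xfin_phi i s : Xfin s -> Xfin (phi i s).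
Proof.
rewrite /Xfin /u_infty /= => sfin; apply: le_lt_trans sfin.
have unE_nd t : nondecreasing_seq (fun n => (un n t)%:E).
  by move=> p q pq; rewrite lee_fin; exact: un_nondecreasing.
apply: lime_le; first exact: ereal_nondecreasing_is_cvgn.
apply: nearW => n; apply: (@le_trans _ _ (un n.+1 s)%:E).
  by rewrite lee_fin un_phi_le.
rewrite (cvg_lim _ (ereal_nondecreasing_cvgn (unE_nd s))) //.
by apply: ereal_sup_ubound; exists n.+1.
Qed.

Definition phi_fin (i : 'I_m) (s : Xfin) : Xfin :=
  SigSub (mem_set (Xfin_phi i (set_valP s))).

End Iterates.

(* Main.v *)
Require Import Defs.
From HB Require Import structures.
From mathcomp Require Import all_boot all_order all_algebra complex.
From mathcomp Require Import all_classical all_reals all_analysis.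
From mathcomp Require Import ring.
Set Implicit Arguments.
Unset Strict Implicit.
Unset Printing Implicit Defensive.
Import Order.TTheory GRing.Theory Num.Theory numFieldNormedType.Exports.
Local Open Scope classical_set_scope.
Local Open Scope ring_scope.
Local Open Scope complex_scope.
Local Open Scope ring_scope.

(** The diagonal controls everything.  Since [LK >= K] and [L] preserves positive
    definiteness, the iterates [Kn] increase in the kernel order, so for fixed
    points [s], [t] and a scalar [c] the binary Hermitian form
    [two_point_form (Kn n) s t c] is a nondecreasing sequence of reals.  The
    parallelogram law bounds it by twice the weighted diagonal values, which stay
    finite on [Xfin]; hence it converges.  Polarization expresses [Kn n s t] as a
    fixed combination of four such forms, so the iterates converge pointwise on
    [Xfin] ([Kn_cvg]).

    The limit inherits the remaining properties because positive definiteness is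
    a closed condition under pointwise convergence ([posdef_lim]): it is applied
    to [Kn n], to [Kn n - K], and to [J - Kn n], the last one being positive
    definite since [J = L^n J >= L^n K] for an [L]-invariant majorant [J].
    Invariance is the passage to the limit in [L (Kn n) = Kn n.+1], and
    uniqueness is that of pointwise limits. *)

(** * Monotone sequences of complex numbers *)

Lemma cvg_real_complex (R : realType) (u : nat -> R) (l : R) :
  u n @[n --> \oo] --> l ->
  ((u n)%:C : R[i]^o) @[n --> \oo] --> (l%:C : R[i]^o).
Proof.
move=> ul; apply/cvgrPdist_lt => -[e1 e2].
rewrite ltcE /= => /andP[/eqP -> e1_gt0].
move/cvgrPdist_lt : ul => /(_ _ e1_gt0); apply: filterS => n ln.
by rewrite -raddfB /= normc_def /= expr0n addr0 sqrtr_sqr ltcR.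
Qed.

(** In the order of the complex numbers, comparable numbers share their imaginary
    part, so a nondecreasing sequence moves along a horizontal line and the real
    monotone convergence theorem applies. *)
Lemma complex_nondecreasing_cvg (R : realType) (z : nat -> R[i]) (M : R[i]) :
  (forall n, z n <= z n.+1) -> (forall n, z n <= M) ->
  exists l : R[i], (z n : R[i]^o) @[n --> \oo] --> (l : R[i]^o).
Proof.
move=> z_nd z_le.
have zE n : z n = (complex.Re (z n))%:C + (0 +i* complex.Im M).
  have := z_le n; case: (z n) => a b; case: M {z_le} => c d.
  by rewrite lecE /= => /andP[/eqP -> _]; rewrite /real_complex_def; simpc.
pose u n : R := complex.Re (z n).
have u_nd : nondecreasing_seq u.
  by apply/nondecreasing_seqP => n; have := z_nd n; rewrite lecE => /andP[].
have u_cvg : cvgn u.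
  apply: nondecreasing_is_cvgn => //; exists (complex.Re M) => _ [n _ <-].
  by have := z_le n; rewrite lecE => /andP[].
exists ((limn u)%:C + (0 +i* complex.Im M)).
rewrite (_ : (fun n => _) = fun n => (u n)%:C + (0 +i* complex.Im M) : R[i]^o);
  last exact/funext.
by apply: cvgD; [exact: cvg_real_complex | exact: cvg_cst].
Qed.

(** A nonnegative number is one that equals its norm, and this equation passes to
    the limit. *)
Lemma complex_lim_ge0 (R : realType) (z : nat -> R[i]) (l : R[i]) :
  (forall n, 0 <= z n) ->
  (z n : R[i]^o) @[n --> \oo] --> (l : R[i]^o) -> 0 <= l.
Proof.
move=> z_ge0 zl.
suff -> : l = `|l| by exact: normr_ge0.
apply: (cvg_unique (@norm_hausdorff _ R[i]^o) zl).
have zE : z = fun n => `|z n| by apply/funext => n; rewrite ger0_norm.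
rewrite {1}zE; exact: (cvg_norm zl).
Qed.

Lemma cvg_sum (R : realType) (k : nat) (z : nat -> 'I_k -> R[i])
    (l : 'I_k -> R[i]) :
  (forall i, (z n i : R[i]^o) @[n --> \oo] --> (l i : R[i]^o)) ->
  (\sum_(i < k) z n i : R[i]^o) @[n --> \oo] --> (\sum_(i < k) l i : R[i]^o).
Proof.
move=> zl; have add_cont := @add_continuous R[i]^o.
exact: (@cvg_big R[i]^o _ _ _ predT add_cont _ _ _ (fun i n => z n i) l _
  (fun i _ => zl i)).
Qed.

(** * Positive definite kernels *)

Lemma posdef_lim (R : realType) (Y : Type) (F : nat -> ckernel R Y)
    (G : ckernel R Y) :
  (forall n, posdef (F n)) ->
  (forall s t, (F n s t : R[i]^o) @[n --> \oo] --> (G s t : R[i]^o)) ->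
  posdef G.
Proof.
move=> Fpd FG k c s.
apply: (@complex_lim_ge0 _ (fun n => \sum_(a < k) \sum_(b < k)
  Num.conj (c a) * c b * F n (s a) (s b))) => [n|]; first exact: Fpd.
apply: cvg_sum => a; apply: cvg_sum => b.
by apply: cvgMl_tmp; exact: FG.
Qed.

Lemma posdef_comp (R : realType) (Y Z : Type) (f : Z -> Y) (J : ckernel R Y) :
  posdef J -> posdef (fun s t => J (f s) (f t)).
Proof. by move=> Jpd n c s; exact: (Jpd n c (f \o s)). Qed.

Lemma kernel_le_trans (R : realType) (Y : Type) (J1 J2 J3 : ckernel R Y) :
  kernel_le J1 J2 -> kernel_le J2 J3 -> kernel_le J1 J3.
Proof.
move=> J12 J23 n c s.
rewrite (_ : \sum_(a < n) _ = \sum_(a < n) \sum_(b < n)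
    Num.conj (c a) * c b * (J2 (s a) (s b) - J1 (s a) (s b)) +
  \sum_(a < n) \sum_(b < n)
    Num.conj (c a) * c b * (J3 (s a) (s b) - J2 (s a) (s b))).
  exact: addr_ge0 (J12 n c s) (J23 n c s).
rewrite -big_split; apply: eq_bigr => a _.
by rewrite -big_split; apply: eq_bigr => b _ /=; ring.
Qed.

Lemma kernel_le_refl (R : realType) (Y : Type) (J : ckernel R Y) :
  kernel_le J J.
Proof.
move=> n c s; rewrite big1 // => a _; rewrite big1 // => b _.
by rewrite subrr mulr0.
Qed.

Lemma pullback_le (R : realType) (Y : Type) (m : nat) (phi : 'I_m -> Y -> Y)
    (J1 J2 : ckernel R Y) :
  kernel_le J1 J2 -> kernel_le (pullback phi J1) (pullback phi J2).
Proof.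
move=> /(posdef_pullback phi); congr posdef.
by apply/funext => s; apply/funext => t; rewrite /pullback sumrB.
Qed.

(** The value of [sum_(a, b) conj (c a) * c b * J (s a) (s b)] on the two-element
    family with points [s], [t] and coefficients [1], [c]. *)
Definition two_point_form (R : realType) (Y : Type) (J : ckernel R Y)
    (s t : Y) (c : R[i]) : R[i] :=
  J s s + c * J s t + Num.conj c * J t s + Num.conj c * c * J t t.

Lemma two_point_form_ge0 (R : realType) (Y : Type) (J : ckernel R Y) s t c :
  posdef J -> 0 <= two_point_form J s t c.
Proof.
move=> /(_ 2%N (fun a => if a == 0 then 1 else c)
               (fun a => if a == 0 then s else t)).
rewrite !big_ord_recl !big_ord0 /= !addr0 conjC1 !mul1r mulr1.
by rewrite /two_point_form !addrA.
Qed.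

Lemma two_point_form_le (R : realType) (Y : Type) (J1 J2 : ckernel R Y) s t c :
  kernel_le J1 J2 -> two_point_form J1 s t c <= two_point_form J2 s t c.
Proof.
move=> /(two_point_form_ge0 s t c) form_ge0; rewrite -subr_ge0.
by move: form_ge0; congr (0 <= _); rewrite /two_point_form; ring.
Qed.

(** The forms at [c] and [- c] are both nonnegative and add up to the right-hand
    side. *)
Lemma two_point_form_le_diag (R : realType) (Y : Type) (J : ckernel R Y) s t c :
  posdef J ->
  two_point_form J s t c <= (J s s + Num.conj c * c * J t t) *+ 2.
Proof.
move=> /(two_point_form_ge0 s t (- c)) form_ge0; rewrite -subr_ge0.
by move: form_ge0; congr (0 <= _); rewrite /two_point_form rmorphN /=; ring.
Qed.

(** Weighting the form at [c] by [conj c] and summing over the fourth roots of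
    unity kills every term but [c * J s t], because [conj c], [conj c ^ 2] and
    [conj c * (conj c * c) = conj c] all sum to zero; the surviving coefficients
    [conj c * c = 1] sum to [4]. *)
Lemma polarization (R : realType) (Y : Type) (J : ckernel R Y) s t :
  J s t = 4%:R^-1 * (two_point_form J s t 1 - two_point_form J s t (- 1)
    - 'i * two_point_form J s t 'i + 'i * two_point_form J s t (- 'i)).
Proof.
apply: (mulfI (_ : 4%:R != 0)); first by rewrite pnatr_eq0.
rewrite mulVKf ?pnatr_eq0 // /two_point_form !rmorphN /= conjC1 conjCi.
have i2 := sqrCi R[i].
by ring: i2.
Qed.

(** * Convergence of the iterates *)

Section Convergence.
Context (R : realType) (X : Type) (m : nat).
Variables (phi : 'I_m -> X -> X) (K : ckernel R X).
Hypotheses (Kpd : posdef K) (LK_ge_K : kernel_le K (pullback phi K)).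

Lemma Kn_ge n : kernel_le K (Kn phi K n).
Proof.
elim: n => [|n IHn]; first exact: kernel_le_refl.
exact: kernel_le_trans IHn (Kn_leS LK_ge_K n).
Qed.

Lemma Xfin_diag_bounded s :
  Xfin phi K s -> exists M : R, forall n, Kn phi K n s s <= M%:C.
Proof.
rewrite /Xfin /= => sfin.
have un_le n : ((un phi K n s)%:E <= u_infty phi K s)%E.
  rewrite /u_infty (cvg_lim _ (ereal_nondecreasing_cvgn _)) //.
    by apply: ereal_sup_ubound; exists n.
  by move=> p q pq; rewrite lee_fin; exact: un_nondecreasing.
exists (fine (u_infty phi K s)) => n.
rewrite Kn_diag // lecR -lee_fin fineK //.
by rewrite fin_numElt sfin andbT (lt_le_trans (ltNyr _) (un_le 0%N)).
Qed.

Lemma two_point_form_Kn_cvg s t c : Xfin phi K s -> Xfin phi K t ->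
  exists l : R[i], (two_point_form (Kn phi K n) s t c : R[i]^o) @[n --> \oo]
    --> (l : R[i]^o).
Proof.
move=> /Xfin_diag_bounded[Ms sM] /Xfin_diag_bounded[Mt tM].
apply: (@complex_nondecreasing_cvg _ _
  ((Ms%:C + Num.conj c * c * Mt%:C) *+ 2)) => n.
  exact: two_point_form_le (Kn_leS LK_ge_K n).
apply: le_trans (two_point_form_le_diag s t c (posdef_Kn phi Kpd n)) _.
by rewrite lerMn2r lerD //= ler_wpM2l // mulrC mul_conjC_ge0.
Qed.

Lemma Kn_cvg s t : Xfin phi K s -> Xfin phi K t ->
  exists l : R[i], (Kn phi K n s t : R[i]^o) @[n --> \oo] --> (l : R[i]^o).
Proof.
move=> sfin tfin; pose q c n : R[i]^o := two_point_form (Kn phi K n) s t c.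
have q_cvg c : exists l : R[i]^o, q c n @[n --> \oo] --> l.
  exact: two_point_form_Kn_cvg.
have [[l1 cvg1] [l2 cvg2]] := (q_cvg 1, q_cvg (- 1)).
have [[l3 cvg3] [l4 cvg4]] := (q_cvg 'i, q_cvg (- 'i)).
exists (4%:R^-1 * (l1 - l2 - 'i * l3 + 'i * l4)).
rewrite (_ : (fun n => _) = fun n =>
    4%:R^-1 * (q 1 n - q (- 1) n - 'i * q 'i n + 'i * q (- 'i) n));
  last by apply/funext => n; exact: polarization.
exact: cvgMl_tmp
  (cvgD (cvgB (cvgB cvg1 cvg2) (cvgMl_tmp cvg3)) (cvgMl_tmp cvg4)).
Qed.

(** The minimality of the limit comes from this bound: applying [L] to
    [J >= Kn n] gives [J = LJ >= Kn n.+1]. *)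
Lemma invariant_ge_Kn (J : ckernel R (Xfin phi K)) n :
  kernel_le (kernel_restr K) J -> pullback (phi_fin Kpd LK_ge_K) J = J ->
  kernel_le (kernel_restr (Kn phi K n)) J.
Proof.
move=> KJ LJ; elim: n => [//|n /(pullback_le (phi_fin Kpd LK_ge_K))].
by rewrite LJ.
Qed.

End Convergence.

Theorem theorem3p4 (R : realType) (X : Type) (m : nat) (m_ge1 : (1 <= m)%N)
    (phi : 'I_m -> X -> X) (K : ckernel R X)
    (Kpd : posdef K) (LK_ge_K : kernel_le K (pullback phi K)) :
  exists! Kinf : ckernel R (Xfin phi K),
    [/\ (forall s t : Xfin phi K,
          (Kn phi K n (val s) (val t) : R[i]^o) @[n --> \oo]
            --> (Kinf s t : R[i]^o)),
        posdef Kinf,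
        (forall s t : Xfin phi K,
          pullback (phi_fin Kpd LK_ge_K) Kinf s t = Kinf s t) /\
        kernel_le (kernel_restr K) Kinf
      & (forall J : ckernel R (Xfin phi K),
          kernel_le (kernel_restr K) J ->
          pullback (phi_fin Kpd LK_ge_K) J = J ->
          kernel_le Kinf J)].
Proof.
have lim_ex (s t : Xfin phi K) := Kn_cvg Kpd LK_ge_K (set_valP s) (set_valP t).
pose Kinf : ckernel R (Xfin phi K) := fun s t => sval (cid (lim_ex s t)).
have Kinf_lim s t : (Kn phi K n (val s) (val t) : R[i]^o) @[n --> \oo]
    --> (Kinf s t : R[i]^o) := svalP (cid (lim_ex s t)).
exists Kinf; split; last first.
  move=> K' [K'_lim _ _ _]; apply/funext => s; apply/funext => t.
  exact: (cvg_unique (@norm_hausdorff _ R[i]^o) (Kinf_lim s t) (K'_lim s t)).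
split => //.
- apply: (posdef_lim _ Kinf_lim) => n.
  exact: posdef_comp (posdef_Kn phi Kpd n).
- split=> [s t|].
    apply: (cvg_unique (@norm_hausdorff _ R[i]^o) (_ :
      (Kn phi K n.+1 (val s) (val t) : R[i]^o) @[n --> \oo] --> _)).
      apply: cvg_sum => i.
      exact: (Kinf_lim (phi_fin Kpd LK_ge_K i s) (phi_fin Kpd LK_ge_K i t)).
    by have := Kinf_lim s t; rewrite -cvg_shiftS.
  apply: (@posdef_lim _ _
    (fun n s t => Kn phi K n (val s) (val t) - kernel_restr K s t)) => [n|s t].
    exact: posdef_comp (Kn_ge LK_ge_K n).
  by apply: cvgB; [exact: Kinf_lim | exact: cvg_cst].
- move=> J KJ LJ; apply: (@posdef_lim _ _
    (fun n s t => J s t - Kn phi K n (val s) (val t))) => [n|s t].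
    exact: invariant_ge_Kn KJ LJ.
  by apply: cvgB; [exact: cvg_cst | exact: Kinf_lim].
Qed.
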